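(* Let $\mathcal{A}$ be a finite set, let $P_A \in \Delta(\mathcal{A})$ and let $(G_a)_{a \in \mathcal{A}}$ be a family of probabilistic graphs. If $P_A \in \Delta_k(\mathcal{A})$ for some positive integer $k$, then $$\overline{H}\left(\bigsqcup_{a \in \mathcal{A}}^{P_A} G_a\right) = \frac{1}{k}\,\overline{H}\left(\bigwedge_{a \in \mathcal{A}} G_a^{\wedge k P_A(a)}\right).$$
   Context: $\Delta(\mathcal{X})$ denotes the set of probability distributions on a finite set $\mathcal{X}$. The type $T_{a^k}\in\Delta(\mathcal{A})$ of a sequence $a^k\in\mathcal{A}^k$ is its empirical distribution, $T_{a^k}(a)=\frac1k|\{t\le k: a_t=a\}|$; $\Delta_k(\mathcal{A})\subset\Delta(\mathcal{A})$ is the set of types of sequences in $\mathcal{A}^k$ (so $kP_A(a)$ is a nonnegative integer for every $a$ when $P_A\in\Delta_k(\mathcal{A})$). A probabilistic graph is a tuple $G=(\mathcal{V},\mathcal{E},P_V)$ where $(\mathcal{V},\mathcal{E})$ is a finite simple undirected graph and $P_V\in\Delta(\mathcal{V})$. AND product: $G_1\wedge G_2$ has vertex set $\mathcal{V}_1\times\mathcal{V}_2$, distribution $P_{V_1}P_{V_2}$ (product distribution), and two distinct vertices $(v_1,v_2),(v_1',v_2')$ are adjacent iff ($v_1=v_1'$ or $v_1v_1'\in\mathcal{E}_1$) and ($v_2=v_2'$ or $v_2v_2'\in\mathcal{E}_2$). $G^{\wedge n}$ is the $n$-fold AND product $G\wedge\dots\wedge G$; $G^{\wedge 0}$ is the one-vertex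 graph (i.e. the factor is omitted from products). Disjoint union: for $G_a=(\mathcal{V}_a,\mathcal{E}_a,P_{V_a})$, $\bigsqcup_{a\in\mathcal{A}}^{P_A}G_a$ has vertex set the disjoint union of the $\mathcal{V}_a$; two vertices are adjacent iff they lie in the same $\mathcal{V}_a$ and are adjacent in $G_a$; its distribution is $\sum_{a}P_A(a)P_{V_a}$. A coloring of $G$ is a map $c$ on $\mathcal{V}$ such that adjacent vertices receive different values. The chromatic entropy is $H_\chi(G)=\inf\{H(c(V)) : c \text{ a coloring of } G\}$, where $V\sim P_V$ and $H$ is Shannon entropy (logarithms in base 2). The complementary graph entropy is $\overline{H}(G)=\lim_{n\to\infty}\frac1n H_\chi(G^{\wedge n})$ (the limit exists). *)

(* Defs.v *)
From HB Require Import structures.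
From mathcomp Require Import all_boot all_order all_algebra.
From mathcomp Require Import all_classical all_reals all_analysis.

Set Implicit Arguments.
Unset Strict Implicit.
Unset Printing Implicit Defensive.

Import Order.TTheory GRing.Theory Num.Theory.
Import numFieldNormedType.Exports.
Local Open Scope classical_set_scope.
Local Open Scope ring_scope.

Record fdist (R : realType) (X : finType) := FDist {
  prob :> X -> R;
  prob_ge0 : forall x, 0 <= prob x;
  prob_sum1 : \sum_x prob x = 1 }.

Definition emp_type (R : realType) (A : finType) (k : nat) (s : k.-tuple A)
    (a : A) : R :=
  k%:R^-1 * #|[pred t : 'I_k | tnth s t == a]|%:R.

(* P \in Delta_k(A) *)
Definition is_type (R : realType) (A : finType) (k : nat) (P : fdist R A) : Prop :=
  exists s : k.-tuple A, forall a, P a = emp_type R s a.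

(* Since [fdist] forces the total mass to be 1, vertex sets are nonempty. *)
Record pgraph (R : realType) := PGraph {
  vert : finType;
  adj : rel vert;
  adj_sym : symmetric adj;
  adj_irr : irreflexive adj;
  vdist : fdist R vert }.

Section AndProduct.
Variables (R : realType) (G1 G2 : pgraph R).
Let V : finType := (vert G1 * vert G2)%type.

Definition and_adj : rel V := fun u v =>
  [&& u != v,
      (u.1 == v.1) || adj u.1 v.1 &
      (u.2 == v.2) || adj u.2 v.2].

Lemma and_adj_sym : symmetric and_adj.
Proof.
move=> u v; rewrite /and_adj eq_sym (eq_sym u.1) (eq_sym u.2).
by rewrite (@adj_sym _ G1 u.1) (@adj_sym _ G2 u.2).
Qed.

Lemma and_adj_irr : irreflexive and_adj.
Proof. by move=> u; rewrite /and_adj eqxx. Qed.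

Definition and_prob (u : V) : R := vdist G1 u.1 * vdist G2 u.2.

Lemma and_prob_ge0 u : 0 <= and_prob u.
Proof. by rewrite mulr_ge0 ?prob_ge0. Qed.

Lemma and_prob_sum1 : \sum_u and_prob u = 1.
Proof.
rewrite -(pair_bigA _ (fun x y => vdist G1 x * vdist G2 y)) /=.
under eq_bigr do rewrite -mulr_sumr prob_sum1 mulr1.
exact: prob_sum1.
Qed.

Definition and_graph : pgraph R :=
  PGraph and_adj_sym and_adj_irr (FDist and_prob_ge0 and_prob_sum1).

End AndProduct.

Section OneVertex.
Variable R : realType.

Definition one_adj : rel unit := fun _ _ => false.

Lemma one_adj_sym : symmetric one_adj. Proof. by []. Qed.
Lemma one_adj_irr : irreflexive one_adj. Proof. by []. Qed.

Definition one_prob (_ : unit) : R := 1.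

Lemma one_prob_ge0 u : 0 <= one_prob u. Proof. exact: ler01. Qed.

Lemma one_prob_sum1 : \sum_u one_prob u = 1.
Proof. by rewrite /one_prob sumr_const card_unit. Qed.

Definition one_graph : pgraph R :=
  PGraph one_adj_sym one_adj_irr (FDist one_prob_ge0 one_prob_sum1).

End OneVertex.
Arguments one_graph {R}.

(* G /\ (G /\ ... /\ G) with n factors when n > 0, and the one-vertex graph
   when n = 0. *)
Definition and_pow (R : realType) (G : pgraph R) (n : nat) : pgraph R :=
  iterop n (@and_graph R) G one_graph.

(* The factors are taken in the enumeration order of A, closed by the one-vertex
   graph; the AND product is associative and commutative, with the one-vertex
   graph as unit, up to isomorphism of probabilistic graphs. *)
Definition and_prod (R : realType) (A : finType) (G : A -> pgraph R) : pgraph R :=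
  \big[@and_graph R/one_graph]_(a : A) G a.

Section DisjointUnion.
Variables (R : realType) (A : finType) (P : fdist R A) (G : A -> pgraph R).
Let V : finType := {a : A & vert (G a)}.

(* [tagged_as u v] is the second component of [v], transported to the
   component of [u] when both have the same index. *)
Definition union_adj : rel V := fun u v =>
  (tag u == tag v) && adj (tagged u) (tagged_as u v).

Lemma union_adj_sym : symmetric union_adj.
Proof.
move=> [a x] [b y]; rewrite /union_adj /= eq_sym.
case: eqP => //= e; case: _ / e x => x.
by rewrite !tagged_asE adj_sym.
Qed.

Lemma union_adj_irr : irreflexive union_adj.
Proof. by move=> [a x]; rewrite /union_adj /= tagged_asE adj_irr andbF. Qed.

(* The value of sum_a P(a) P_{V_a} at a vertex: only the component containing
   it contributes. *)
Definition union_prob (u : V) : R := P (tag u) * vdist (G (tag u)) (tagged u).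

Lemma union_prob_ge0 u : 0 <= union_prob u.
Proof. by rewrite mulr_ge0 ?prob_ge0. Qed.

Lemma union_prob_sum1 : \sum_u union_prob u = 1.
Proof.
rewrite -(@sig_big_dep _ _ _ _ _ xpredT (fun _ => xpredT)
            (fun a x => P a * vdist (G a) x)) /=.
under eq_bigr do rewrite -mulr_sumr prob_sum1 mulr1.
exact: prob_sum1.
Qed.

Definition disjoint_union : pgraph R :=
  PGraph union_adj_sym union_adj_irr (FDist union_prob_ge0 union_prob_sum1).

End DisjointUnion.

Definition coloring (R : realType) (G : pgraph R) (C : finType)
    (c : vert G -> C) : Prop :=
  forall u v, adj u v -> c u <> c v.

Definition log2 (R : realType) (x : R) : R := ln x / ln 2.

(* Terms with p x = 0 vanish, giving the convention 0 log 0 = 0. *)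
Definition entropy (R : realType) (X : finType) (p : X -> R) : R :=
  - \sum_x p x * log2 (p x).

(* The law of c(V) when V ~ P_V. *)
Definition color_law (R : realType) (G : pgraph R) (C : finType)
    (c : vert G -> C) (x : C) : R :=
  \sum_(v | c v == x) vdist G v.

Definition chromatic_entropy (R : realType) (G : pgraph R) : R :=
  inf [set h : R | exists (C : finType) (c : vert G -> C),
                     coloring c /\ h = entropy (color_law c)].

Definition complementary_entropy (R : realType) (G : pgraph R) : R :=
  lim ((fun n : nat => n%:R^-1 * chromatic_entropy (and_pow G n)) @ \oo).

(* Main.v *)
(** Write U for the disjoint union.  A vertex of the n-fold AND power of U spells
    a word of length n over A, words are never linked to one another, and the
    component of a word t is the AND product W(t) of the graphs of its letters,
    which up to isomorphism depends only on the letter counts of t.  Conditioning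
    on the word bounds the chromatic entropy of the power from below by the mean
    of H_chi(W(t)); reusing one coloring for all words with the same counts
    bounds it from above by that mean plus the logarithm of the number of types,
    at most |A| log (n + 1).  Since H_chi is monotone and subadditive under AND
    products, H_chi(W(t)) is Lipschitz in the letter counts, which deviate from
    n P in mean by at most sqrt n.  Hence when n P is integral, the chromatic
    entropy of the n-th power is within O(sqrt n) of H_chi(W(s)) for any word s
    with counts n P; take n = m k.  Fekete's lemma gives convergence for U, and
    the other limit is a rescaled subsequence of it. *)

Require Import Defs.
From mathcomp Require Import all_boot all_order all_algebra.
From mathcomp Require Import all_classical all_reals all_analysis.
From mathcomp Require Import zify ring lra.

Set Implicit Arguments.
Unset Strict Implicit.
Unset Printing Implicit Defensive.

Import Order.TTheory GRing.Theory Num.Theory.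
Import numFieldNormedType.Exports.
Local Open Scope ring_scope.

(** * Entropy *)

Section Entropy.
Variable R : realType.
Implicit Types (x y b : R) (I J : finType).

Definition eta x : R := - (x * log2 x).

Lemma entropy_eta I (p : I -> R) : entropy p = \sum_i eta (p i).
Proof. by rewrite /entropy sumrN. Qed.

Lemma ln2_gt0 : 0 < ln 2 :> R.
Proof. by rewrite ln_gt0 // ltr1n. Qed.

Lemma eta0 : eta 0 = 0.
Proof. by rewrite /eta mul0r oppr0. Qed.

Lemma eta_ge0 x : x <= 1 -> 0 <= eta x.
Proof.
move=> x1; rewrite /eta oppr_ge0 /log2 mulrA.
rewrite mulr_le0_ge0 ?invr_ge0 ?(ltW ln2_gt0) //.
have [x0|x0] := leP x 0; first by rewrite ln0 // mulr0.
by rewrite mulr_ge0_le0 ?(ltW x0) ?ln_le0.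
Qed.

Lemma log2M x y : 0 < x -> 0 < y -> log2 (x * y) = log2 x + log2 y.
Proof. by move=> x0 y0; rewrite /log2 lnM ?posrE // mulrDl. Qed.

Lemma log2V x : 0 < x -> log2 x^-1 = - log2 x.
Proof. by move=> x0; rewrite /log2 lnV ?posrE // mulNr. Qed.

Lemma etaM x y : 0 <= x -> 0 <= y -> eta (x * y) = y * eta x + x * eta y.
Proof.
rewrite le_eqVlt => /predU1P[<-|x0]; first by rewrite !mul0r eta0 mulr0 addr0.
rewrite le_eqVlt => /predU1P[<-|y0]; first by rewrite !mulr0 eta0 mul0r mulr0 addr0.
by rewrite /eta log2M //; ring.
Qed.

(** The right-hand side is the tangent to the concave function [eta] at [b]; the estimate is
    [ln (1 + y) <= y] at [y = b / x - 1]. *)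
Lemma eta_le_tangent x b : 0 <= x -> 0 < b ->
  eta x <= - (x * log2 b) + (b - x) / ln 2.
Proof.
move=> + b0; rewrite le_eqVlt => /predU1P[<-|x0].
  by rewrite eta0 mul0r oppr0 add0r addr0 divr_ge0 ?(ltW b0) ?(ltW ln2_gt0).
have h : ln b - ln x <= b / x - 1.
  rewrite -ln_div ?posrE // -[X in ln X](addrNK 1) addrC; apply: le_ln1Dx.
  by rewrite ltrBrDr addNr divr_gt0.
have {}h : x * (ln b - ln x) <= b - x.
  have := ler_wpM2l (ltW x0) h.
  by rewrite [X in _ <= X]mulrBr mulr1 mulrCA mulfV ?mulr1 // gt_eqF.
rewrite /eta /log2 !mulrA -!mulNr -mulrDl ler_pM2r ?invr_gt0 ?ln2_gt0 //.
by lra.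
Qed.

(** Jensen's inequality: in the tangent bound at the mean [b], the first-order terms average to
    zero. *)
Lemma eta_concave I (q : fdist R I) (r : I -> R) : (forall i, 0 <= r i) ->
  \sum_i q i * eta (r i) <= eta (\sum_i q i * r i).
Proof.
move=> r0; set b := \sum_i q i * r i.
have qr0 i : 0 <= q i * r i by rewrite mulr_ge0 ?prob_ge0.
have : 0 <= b by apply: sumr_ge0.
rewrite le_eqVlt => /predU1P[b0|b0].
  (* There is no tangent at 0, but a zero mean forces every [q i * r i] to vanish. *)
  rewrite -b0 eta0 big1 // => i _.
  have /psumr_eq0P/(_ i isT)/eqP : \sum_i q i * r i = 0 by rewrite [RHS]b0.
  move=> /(_ (fun i _ => qr0 i)); rewrite mulf_eq0 => /orP[/eqP->|/eqP->].
    by rewrite mul0r.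
  by rewrite eta0 mulr0.
apply: (@le_trans _ _ (\sum_i (- (q i * r i) * log2 b + (q i * b - q i * r i) / ln 2))).
  apply: ler_sum => i _.
  have := ler_wpM2l (prob_ge0 q i) (eta_le_tangent (r0 i) b0).
  by move/le_trans; apply; rewrite le_eqVlt; apply/orP; left; apply/eqP; ring.
rewrite big_split /= -!mulr_suml sumrB sumrN -mulr_suml prob_sum1 mul1r subrr mul0r.
by rewrite addr0 mulNr.
Qed.

(** The tangent is taken at the uniform weight [#|I|%:R^-1], where the corrections [b - q i] sum to
    zero. *)
Lemma entropy_le_log2_card I (q : fdist R I) : entropy q <= log2 #|I|%:R.
Proof.
have I0 : 0 < #|I|%:R :> R.
  rewrite ltr0n lt0n; apply/eqP => /card0_eq I0.
  by have /eqP := prob_sum1 q; rewrite big_pred0 // eq_sym oner_eq0.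
have Iv0 : 0 < #|I|%:R^-1 :> R by rewrite invr_gt0.
rewrite entropy_eta.
apply: le_trans (ler_sum _ (fun i _ => eta_le_tangent (prob_ge0 q i) Iv0)) _.
rewrite big_split /= sumrN -!mulr_suml prob_sum1 mul1r sumrB prob_sum1 sumr_const.
rewrite -[X in X - 1]mulr_natl mulfV ?(gt_eqF I0) // subrr mul0r addr0.
by rewrite log2V // opprK.
Qed.

Lemma entropy_ge0 I (p : I -> R) : (forall i, p i <= 1) -> 0 <= entropy p.
Proof. by move=> p1; rewrite entropy_eta sumr_ge0 // => i _; rewrite eta_ge0. Qed.

Lemma entropy_prod I J (p : I -> R) (r : J -> R) :
  (forall i, 0 <= p i) -> (forall j, 0 <= r j) ->
  \sum_i p i = 1 -> \sum_j r j = 1 ->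
  entropy (fun u : I * J => p u.1 * r u.2) = entropy p + entropy r.
Proof.
move=> p0 r0 p1 r1; rewrite !entropy_eta.
rewrite -(pair_bigA _ (fun i j => eta (p i * r j))) /=.
under eq_bigr => i _.
  under eq_bigr => j _ do rewrite etaM //.
  rewrite big_split /= -mulr_suml -mulr_sumr r1 mul1r.
  over.
by rewrite big_split /= -mulr_suml p1 mul1r.
Qed.

(** Chain rule: an index is drawn from [q], then a letter from the conditional law [r i]. *)
Lemma entropy_sigma I (J : I -> finType) (q : fdist R I)
    (r : forall i, J i -> R) :
  (forall i j, 0 <= r i j) -> (forall i, \sum_j r i j = 1) ->
  entropy (fun u : {i : I & J i} => q (tag u) * r (tag u) (tagged u)) =
  entropy q + \sum_i q i * entropy (r i).
Proof.
move=> r0 r1; rewrite !entropy_eta.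
rewrite -(@sig_big_dep _ _ _ _ _ xpredT (fun _ => xpredT)
            (fun i j => eta (q i * r i j))) /=.
rewrite -big_split; apply: eq_bigr => i _ /=.
under eq_bigr => j _ do rewrite etaM ?prob_ge0 //.
by rewrite big_split /= -mulr_suml -mulr_sumr r1 mul1r entropy_eta.
Qed.

End Entropy.

(** * Chromatic entropy, disjoint unions and AND products *)

Section ChromaticEntropy.
Variable R : realType.
Implicit Types (G H K : pgraph R) (I J : finType).

Lemma sum_sigma I (J : I -> finType) (P : pred {i : I & J i})
    (F : {i : I & J i} -> R) :
  \sum_(u | P u) F u = \sum_(i : I) \sum_(x : J i | P (Tagged J x)) F (Tagged J x).
Proof.
rewrite (@sig_big_dep _ _ _ _ _ xpredT (fun (i : I) (x : J i) => P (Tagged J x))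
           (fun (i : I) (x : J i) => F (Tagged J x))) /=.
by apply: eq_big => [[i x]|[i x] _].
Qed.

Lemma color_law_ge0 G (C : finType) (c : vert G -> C) z : 0 <= color_law c z.
Proof. by apply: sumr_ge0 => v _; apply: prob_ge0. Qed.

Lemma color_law_sum1 G (C : finType) (c : vert G -> C) :
  \sum_z color_law c z = 1.
Proof. by rewrite -(prob_sum1 (vdist G)) [RHS](partition_big c xpredT). Qed.

Lemma color_law_le1 G (C : finType) (c : vert G -> C) z : color_law c z <= 1.
Proof.
rewrite -(color_law_sum1 c) (bigD1 z) //= lerDl sumr_ge0 // => y _.
exact: color_law_ge0.
Qed.

Lemma chromatic_entropy_has_inf G :
  has_inf [set h : R | exists (C : finType) (c : vert G -> C),
                         coloring c /\ h = entropy (color_law c)]%classic.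
Proof.
split.
  exists (entropy (color_law (@id (vert G)))); exists (vert G), id; split=> //.
  by move=> u v + uv; rewrite uv adj_irr.
exists 0 => _ [C [c [_ ->]]]; apply: entropy_ge0 => z; exact: color_law_le1.
Qed.

Lemma chromatic_entropy_le G (C : finType) (c : vert G -> C) :
  coloring c -> chromatic_entropy G <= entropy (color_law c).
Proof.
move=> cc; apply: ge_inf; last by exists C, c.
by have [] := chromatic_entropy_has_inf G.
Qed.

Lemma le_chromatic_entropy G (x : R) :
  (forall (C : finType) (c : vert G -> C), coloring c ->
     x <= entropy (color_law c)) -> x <= chromatic_entropy G.
Proof.
move=> xP; apply: lb_le_inf; first by have [] := chromatic_entropy_has_inf G.
by move=> _ [C [c [cc ->]]]; apply: xP.
Qed.

Lemma chromatic_entropy_adherent G (e : R) : 0 < e ->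
  exists (C : finType) (c : vert G -> C),
    coloring c /\ entropy (color_law c) < chromatic_entropy G + e.
Proof.
move=> e0; have [_ [C [c [cc ->]]] h] :=
  inf_adherent e0 (chromatic_entropy_has_inf G).
by exists C, c.
Qed.

Lemma chromatic_entropy_ge0 G : 0 <= chromatic_entropy G.
Proof.
by apply: le_chromatic_entropy => C c _; apply: entropy_ge0 => z;
   apply: color_law_le1.
Qed.

(** A coloring of the union restricts to every component, and its law is the [q]-mixture of the
    restricted laws; concavity of [eta] is applied color by color. *)
Lemma chromatic_entropy_union_ge I (q : fdist R I) (G : I -> pgraph R) :
  \sum_i q i * chromatic_entropy (G i) <= chromatic_entropy (disjoint_union q G).
Proof.
apply: le_chromatic_entropy => C c cc.
pose ci i (x : vert (G i)) := c (Tagged (fun i => vert (G i)) x).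
have cci i : coloring (ci i).
  by move=> u v uv; apply: cc => /=; rewrite /union_adj /= eqxx tagged_asE.
have lawE z : color_law c z = \sum_i q i * color_law (ci i) z.
  by rewrite /color_law sum_sigma; apply: eq_bigr => i _; rewrite mulr_sumr.
apply: (@le_trans _ _ (\sum_i q i * entropy (color_law (ci i)))).
  by apply: ler_sum => i _; rewrite ler_wpM2l ?prob_ge0 ?chromatic_entropy_le.
rewrite entropy_eta; under eq_bigr do rewrite entropy_eta mulr_sumr.
rewrite exchange_big /=; apply: ler_sum => z _; rewrite lawE.
by apply: eta_concave => i; apply: color_law_ge0.
Qed.

(** Tagging colors with their component gives a coloring whose entropy, by the chain rule, is that
    of [q] plus the mean over the components. *)
Lemma chromatic_entropy_union_le I (q : fdist R I) (G : I -> pgraph R) :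
  chromatic_entropy (disjoint_union q G) <=
  log2 #|I|%:R + \sum_i q i * chromatic_entropy (G i).
Proof.
apply/ler_addgt0Pr => e e0.
(* Choice extracts an [e]-optimal coloring of each component; the total slack stays [e] because [q]
   has mass 1. *)
pose w i := cid (chromatic_entropy_adherent (G i) e0).
pose C i : finType := projT1 (w i).
pose wc i := cid (projT2 (w i)).
pose c i : vert (G i) -> C i := projT1 (wc i).
have cP i : coloring (@c i) /\
    entropy (color_law (@c i)) < chromatic_entropy (G i) + e.
  exact: projT2 (wc i).
pose f (u : vert (disjoint_union q G)) : {i : I & C i} :=
  Tagged C (c (tag u) (tagged u)).
have fc : coloring f.
  move=> [i x] [j y]; rewrite /= /union_adj /f /= => /andP[/eqP ij].
  case: _ / ij y => y; rewrite tagged_asE => xy /eqP.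
  by rewrite eq_Tagged /= => /eqP; apply: (cP i).1.
apply: (le_trans (chromatic_entropy_le fc)).
have lawE p : color_law f p = q (tag p) * color_law (@c (tag p)) (tagged p).
  case: p => i z; rewrite /color_law sum_sigma (bigD1 i) //= [X in _ + X]big1.
    rewrite addr0 mulr_sumr; apply: eq_bigl => x.
    by rewrite /f eq_Tagged.
  move=> j ji; rewrite big_pred0 // => x; apply/negbTE/eqP => /(congr1 tag) /= E.
  by rewrite E eqxx in ji.
rewrite entropy_eta; under eq_bigr do rewrite lawE.
rewrite -entropy_eta (@entropy_sigma R I C q (fun i => color_law (@c i))); last 2 first.
- by move=> i z; apply: color_law_ge0.
- by move=> i; apply: color_law_sum1.
rewrite -addrA lerD ?entropy_le_log2_card //.
rewrite -[e]mul1r -(prob_sum1 q) mulr_suml -big_split /=.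
apply: ler_sum => i _; rewrite -mulrDr ler_wpM2l ?prob_ge0 // ltW //.
exact: (cP i).2.
Qed.

(** Adjacent vertices of the product are adjacent in some coordinate, so pairs of colors form a
    coloring; its law is a product and entropies add. *)
Lemma chromatic_entropy_and_le G H :
  chromatic_entropy (and_graph G H) <= chromatic_entropy G + chromatic_entropy H.
Proof.
apply/ler_addgt0Pr => e e0; have e20 : 0 < e / 2 by rewrite divr_gt0.
have [C [c [cc ch]]] := chromatic_entropy_adherent G e20.
have [D [d [dd dh]]] := chromatic_entropy_adherent H e20.
pose f (u : vert (and_graph G H)) : (C * D)%type := (c u.1, d u.2).
have fc : coloring f.
  move=> [u1 u2] [v1 v2] /=; rewrite /and_adj /= xpair_eqE => /and3P[uv h1 h2].
  move=> [] E1 E2; case/orP: h1 => [/eqP E|/cc//].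
  case/orP: h2 => [/eqP E'|/dd//].
  by rewrite E E' !eqxx in uv.
apply: (le_trans (chromatic_entropy_le fc)).
have lawE p : color_law f p = color_law c p.1 * color_law d p.2.
  rewrite /color_law big_distrlr /= pair_big /=.
  by apply: eq_big => [[x y]|[x y] _] //; case: p => p1 p2; rewrite xpair_eqE.
rewrite entropy_eta; under eq_bigr do rewrite lawE.
rewrite -entropy_eta (@entropy_prod R C D (color_law c) (color_law d))
  ?color_law_sum1 //; last 2 first.
- by move=> z; apply: color_law_ge0.
- by move=> z; apply: color_law_ge0.
by rewrite [e]splitr addrACA lerD ?ltW.
Qed.

(* Such a map pulls colorings back without changing their law. *)
Definition pg_hom G H : Prop :=
  exists2 f : vert G -> vert H, {homo f : u v / adj u v} &
    forall y, vdist H y = \sum_(x | f x == y) vdist G x.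

Lemma chromatic_entropy_hom G H :
  pg_hom G H -> chromatic_entropy G <= chromatic_entropy H.
Proof.
case=> f fadj fdist; apply: le_chromatic_entropy => C c cc.
have cfc : coloring (c \o f) by move=> u v /fadj/cc.
apply: (le_trans (chromatic_entropy_le cfc)); rewrite !entropy_eta.
rewrite le_eqVlt; apply/orP; left; apply/eqP/eq_bigr => z _; congr eta.
rewrite /color_law; under [RHS]eq_bigr do rewrite fdist.
rewrite (partition_big f (fun y => c y == z)) //=; apply: eq_bigr => y cy.
by apply: eq_bigl => x; case: (eqVneq (f x) y) => [->|]; rewrite /= ?andbF ?cy.
Qed.

Lemma pg_hom_refl G : pg_hom G G.
Proof. by exists id => // y; rewrite big_pred1_eq. Qed.

Lemma pg_hom_trans G H K : pg_hom G H -> pg_hom H K -> pg_hom G K.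
Proof.
case=> f fadj fd [g gadj gd]; exists (g \o f); first by move=> u v /fadj/gadj.
move=> z; rewrite gd; under eq_bigr do rewrite fd.
rewrite [RHS](partition_big f (fun y => g y == z)) //=; apply: eq_bigr => y gy.
by apply: eq_bigl => x; case: (eqVneq (f x) y) => [->|]; rewrite /= ?andbF ?gy.
Qed.

(* Unlike adj, this reflexive closure is a plain conjunction on AND products. *)
Definition cadj G (u v : vert G) : bool := (u == v) || adj u v.

Lemma adj_cadj G (u v : vert G) : adj u v = (u != v) && cadj u v.
Proof. by rewrite /cadj; case: eqVneq => [->|] //; rewrite adj_irr. Qed.

Lemma cadj_and G H (u v : vert (and_graph G H)) :
  cadj u v = cadj u.1 v.1 && cadj u.2 v.2.
Proof.
rewrite {1}/cadj /= /and_adj.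
by case: eqVneq => //= ->; rewrite /cadj !eqxx.
Qed.

Lemma cadj_refl G (u : vert G) : cadj u u.
Proof. by rewrite /cadj eqxx. Qed.

Lemma pg_hom_and G G' H H' :
  pg_hom G G' -> pg_hom H H' -> pg_hom (and_graph G H) (and_graph G' H').
Proof.
case=> f fadj fd [g gadj gd].
exists (fun u : vert (and_graph G H) => (f u.1, g u.2)); last first.
  move=> [y1 y2] /=; rewrite /and_prob /= fd gd big_distrlr /= pair_big /=.
  by apply: eq_bigl => x; rewrite xpair_eqE.
have homc K K' (h : vert K -> vert K') : {homo h : u v / adj u v} ->
    {homo h : u v / cadj u v}.
  by move=> hadj u v /orP[/eqP->|/hadj huv]; rewrite /cadj ?eqxx ?huv ?orbT.
move=> [u1 u2] [v1 v2] uv; rewrite adj_cadj cadj_and.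
have := uv; rewrite adj_cadj cadj_and => /andP[_ /andP[/= c1 c2]].
rewrite (homc _ _ f) ?(homc _ _ g) //= andbT xpair_eqE.
(* It remains to keep the images distinct: a coordinate that changes does so along an edge, and the
   ends of its image edge differ. *)
move: uv; rewrite adj_cadj xpair_eqE => /andP[+ _].
apply: contra => /andP[/eqP fuv /eqP guv].
case/orP: c1 => [->|/fadj]; last by rewrite fuv adj_irr.
by case/orP: c2 => [->|/gadj]; rewrite // guv adj_irr.
Qed.

Lemma pg_hom_iso G H (f : vert G -> vert H) (g : vert H -> vert G) :
  cancel f g -> cancel g f -> (forall u v, cadj (f u) (f v) = cadj u v) ->
  (forall u, vdist H (f u) = vdist G u) -> pg_hom G H.
Proof.
move=> fK gK fadj fd; exists f.
  by move=> u v; rewrite !adj_cadj fadj (inj_eq (can_inj fK)).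
move=> y; rewrite (big_pred1 (g y)) -?fd ?gK // => x.
by rewrite /= (can2_eq fK gK).
Qed.

(** Morphisms both ways, rather than an isomorphism, already force equal chromatic entropies and are
    stable under AND products. *)
Definition pg_equiv G H : Prop := pg_hom G H /\ pg_hom H G.

Lemma chromatic_entropy_equiv G H :
  pg_equiv G H -> chromatic_entropy G = chromatic_entropy H.
Proof. by case=> GH HG; apply/eqP; rewrite eq_le !chromatic_entropy_hom. Qed.

Lemma pg_equiv_refl G : pg_equiv G G.
Proof. by split; apply: pg_hom_refl. Qed.

Lemma pg_equiv_sym G H : pg_equiv G H -> pg_equiv H G.
Proof. by case. Qed.

Lemma pg_equiv_trans G H K : pg_equiv G H -> pg_equiv H K -> pg_equiv G K.
Proof.
by case=> GH HG [HK KH]; split; [apply: pg_hom_trans GH HK|apply: pg_hom_trans KH HG].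
Qed.

Lemma pg_equiv_and G G' H H' :
  pg_equiv G G' -> pg_equiv H H' -> pg_equiv (and_graph G H) (and_graph G' H').
Proof. by case=> ? ? [? ?]; split; apply: pg_hom_and. Qed.

Lemma pg_equiv_iso G H (f : vert G -> vert H) (g : vert H -> vert G) :
  cancel f g -> cancel g f -> (forall u v, cadj (f u) (f v) = cadj u v) ->
  (forall u, vdist H (f u) = vdist G u) -> pg_equiv G H.
Proof.
move=> fK gK fadj fd; split; first exact: (pg_hom_iso fK gK).
by apply: (pg_hom_iso gK fK) => [u v|u]; rewrite -?fadj -?fd !gK.
Qed.

(** * Commutative monoid laws of the AND product up to equivalence *)

Lemma and_graphC G H : pg_equiv (and_graph G H) (and_graph H G).
Proof.
apply: (@pg_equiv_iso (and_graph G H) (and_graph H G)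
  (fun u => (u.2, u.1)) (fun u => (u.2, u.1))) => [[]|[]|u v|u] //.
  by rewrite !cadj_and andbC.
by rewrite /= /and_prob mulrC.
Qed.

Lemma and_graphA G H K :
  pg_equiv (and_graph G (and_graph H K)) (and_graph (and_graph G H) K).
Proof.
apply: (@pg_equiv_iso (and_graph G (and_graph H K)) (and_graph (and_graph G H) K)
  (fun u => ((u.1, u.2.1), u.2.2)) (fun u => (u.1.1, (u.1.2, u.2)))).
- by move=> [? []].
- by move=> [[]].
- by move=> u v; rewrite !cadj_and andbA.
- by move=> u; rewrite /= /and_prob /= /and_prob mulrA.
Qed.

Lemma and_graph1 G : pg_equiv (and_graph G one_graph) G.
Proof.
apply: (@pg_equiv_iso (and_graph G one_graph) G fst (fun x => (x, tt))).
- by move=> [? []].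
- by [].
- by move=> u v; rewrite cadj_and [X in _ && X]/cadj andbT.
- by move=> u; rewrite /= /and_prob mulr1.
Qed.

Lemma and_graph1l G : pg_equiv (and_graph one_graph G) G.
Proof. exact: pg_equiv_trans (and_graphC _ _) (and_graph1 _). Qed.

Lemma and_graphCA G H K :
  pg_equiv (and_graph G (and_graph H K)) (and_graph H (and_graph G K)).
Proof.
apply: pg_equiv_trans (and_graphA _ _ _) _.
apply: pg_equiv_trans (pg_equiv_sym (and_graphA _ _ _)).
exact: pg_equiv_and (and_graphC _ _) (pg_equiv_refl _).
Qed.

Lemma chromatic_entropy_and_ge G H :
  chromatic_entropy G <= chromatic_entropy (and_graph G H).
Proof.
(* Deleting the edges that change the second coordinate leaves a union of
   copies of G. *)
have hom : pg_hom (disjoint_union (vdist H) (fun=> G)) (and_graph G H).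
  exists (fun u => (tagged u, tag u)).
    move=> [i x] [j y] /= /andP[/= /eqP ij]; case: _ / ij y => y.
    rewrite tagged_asE => xy; rewrite /and_adj /= xpair_eqE !eqxx xy orbT !andbT.
    by apply: contraTneq xy => ->; rewrite adj_irr.
  move=> [x y] /=; rewrite sum_sigma (bigD1 y) //= [X in _ + X]big1; last first.
    move=> z zy; rewrite big_pred0 // => t.
    by rewrite xpair_eqE (negbTE zy) andbF.
  rewrite addr0 (big_pred1 x); first by rewrite /union_prob /and_prob mulrC.
  by move=> t; rewrite xpair_eqE eqxx andbT.
apply: le_trans (chromatic_entropy_hom hom).
apply: le_trans (chromatic_entropy_union_ge _ _).
by rewrite -mulr_suml prob_sum1 mul1r.
Qed.

End ChromaticEntropy.

(** * Words *)

Section DisjointUnionProduct.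
Variable R : realType.
Implicit Types (I J : finType).

Lemma fdist_pair_ge0 I J (p : fdist R I) (q : fdist R J) (u : I * J) :
  0 <= p u.1 * q u.2.
Proof. by rewrite mulr_ge0 ?prob_ge0. Qed.

Lemma fdist_pair_sum1 I J (p : fdist R I) (q : fdist R J) :
  \sum_(u : I * J) p u.1 * q u.2 = 1.
Proof.
rewrite -(pair_bigA _ (fun i j => p i * q j)) /=.
by under eq_bigr do rewrite -mulr_sumr prob_sum1 mulr1; exact: prob_sum1.
Qed.

Definition fdist_pair I J (p : fdist R I) (q : fdist R J) : fdist R (I * J)%type :=
  FDist (fdist_pair_ge0 p q) (fdist_pair_sum1 p q).

Lemma fdist_map_ge0 I J (f : I -> J) (p : fdist R I) j :
  0 <= \sum_(i | f i == j) p i.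
Proof. by apply: sumr_ge0 => i _; apply: prob_ge0. Qed.

Lemma fdist_map_sum1 I J (f : I -> J) (p : fdist R I) :
  \sum_j \sum_(i | f i == j) p i = 1.
Proof. by rewrite -(prob_sum1 p) [RHS](partition_big f xpredT). Qed.

Definition fdist_map I J (f : I -> J) (p : fdist R I) : fdist R J :=
  FDist (fdist_map_ge0 f p) (fdist_map_sum1 f p).

(** Distributivity of the AND product over disjoint unions: [cadj] in a union forces equal tags, so
    in the product it forces equal pairs of tags. *)
Lemma union_and_union I J (p : fdist R I) (q : fdist R J)
    (G : I -> pgraph R) (H : J -> pgraph R) :
  pg_equiv (and_graph (disjoint_union p G) (disjoint_union q H))
    (disjoint_union (fdist_pair p q) (fun u => and_graph (G u.1) (H u.2))).
Proof.
pose S := disjoint_union (fdist_pair p q) (fun u => and_graph (G u.1) (H u.2)).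
pose T := and_graph (disjoint_union p G) (disjoint_union q H).
pose B (u : I * J) : finType := (vert (G u.1) * vert (H u.2))%type.
pose f (x : vert T) : vert S :=
  @Tagged _ (tag x.1, tag x.2) B (tagged x.1, tagged x.2).
pose g (y : vert S) : vert T :=
  (@Tagged _ (tag y).1 (fun i => vert (G i)) (tagged y).1,
   @Tagged _ (tag y).2 (fun j => vert (H j)) (tagged y).2).
apply: (@pg_equiv_iso _ T S f g).
- by move=> [[i x] [j y]].
- by move=> [[i j] [x y]].
- have cadjU K (r : fdist R K) (F : K -> pgraph R) (u v : vert (disjoint_union r F)) :
      cadj u v = (tag u == tag v) && cadj (tagged u) (tagged_as u v).
    rewrite /cadj -tag_eqE /tag_eq /= /union_adj.
    by case: (tag u == tag v).
  move=> [[i1 x1] [j1 y1]] [[i2 x2] [j2 y2]]; rewrite cadj_and !cadjU /=.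
  rewrite xpair_eqE.
  have [E|] := eqVneq i1 i2; last by [].
  have [F|] := eqVneq j1 j2; last by rewrite ?andbF.
  case: _ / E x2 => x2; case: _ / F y2 => y2 /=.
  by rewrite !tagged_asE cadj_and.
- by move=> [[i x] [j y]]; rewrite /= /and_prob /union_prob /= /and_prob /= /union_prob /=; ring.
Qed.

(** All components over the same [j] are folded onto one copy of [K j]. Edges stay inside
    components, and the masses add up. *)
Lemma pg_hom_union_map I J (f : I -> J) (p : fdist R I)
    (G : I -> pgraph R) (K : J -> pgraph R) :
  (forall i, pg_hom (G i) (K (f i))) ->
  pg_hom (disjoint_union p G) (disjoint_union (fdist_map f p) K).
Proof.
move=> hom.
pose h i := projT1 (cid2 (hom i)).
have hadj i : {homo h i : u v / adj u v} by exact: (s2valP (cid2 (hom i))).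
have hd i y : vdist (K (f i)) y = \sum_(x | h i x == y) vdist (G i) x.
  exact: (s2valP' (cid2 (hom i))).
pose VK j := vert (K j).
exists (fun u : vert (disjoint_union p G) =>
          Tagged VK (h (tag u) (tagged u)) : vert (disjoint_union _ K)).
  move=> [i x] [j y] /= /andP[/= /eqP ij]; case: _ / ij y => y.
  by rewrite tagged_asE => xy; rewrite /union_adj /= eqxx tagged_asE hadj.
move=> [j y]; rewrite [LHS]/= /union_prob /= sum_sigma mulr_suml.
rewrite big_mkcond; apply: eq_bigr => i _ /=.
case: eqP => [ij|nij].
  case: _ / ij y => y; rewrite hd mulr_sumr; apply: eq_bigl => x.
  by rewrite eq_Tagged.
rewrite big_pred0 // => x; apply/negbTE/eqP => /(congr1 tag) /=.
exact: nij.
Qed.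

(** Components with the same image under [f] share one coloring, so naming the component costs the
    logarithm of [#|J|] instead of [#|I|]. *)
Lemma chromatic_entropy_union_map I J (f : I -> J) (p : fdist R I)
    (G : I -> pgraph R) (K : J -> pgraph R) :
  (forall i, pg_equiv (G i) (K (f i))) ->
  chromatic_entropy (disjoint_union p G) <=
  log2 #|J|%:R + \sum_i p i * chromatic_entropy (G i).
Proof.
move=> eqGK.
apply: le_trans (chromatic_entropy_hom (pg_hom_union_map p (fun i => (eqGK i).1))) _.
apply: le_trans (chromatic_entropy_union_le _ _) _.
rewrite lerD2l le_eqVlt; apply/orP; left; apply/eqP.
rewrite [RHS](partition_big f xpredT) //=; apply: eq_bigr => j _.
rewrite mulr_suml; apply: eq_bigr => i /eqP <-.
by rewrite (chromatic_entropy_equiv (eqGK i)).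
Qed.

(** [iterop] gives [G] itself at exponent 1, without a unit factor, so this recursion holds only up
    to equivalence there. *)
Lemma and_powS (G : pgraph R) n :
  pg_equiv (and_pow G n.+1) (and_graph G (and_pow G n)).
Proof.
case: n => [|n]; first exact/pg_equiv_sym/and_graph1.
exact: pg_equiv_refl.
Qed.

Lemma and_powD (G : pgraph R) m n :
  pg_equiv (and_pow G (m + n)) (and_graph (and_pow G m) (and_pow G n)).
Proof.
elim: m => [|m IHm]; first exact/pg_equiv_sym/and_graph1l.
apply: pg_equiv_trans (and_powS _ _) _.
apply: pg_equiv_trans (pg_equiv_and (pg_equiv_refl _) IHm) _.
apply: pg_equiv_trans (and_graphA _ _ _) _.
exact: pg_equiv_and (pg_equiv_sym (and_powS _ _)) (pg_equiv_refl _).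
Qed.

Lemma pg_equiv_and_pow (G H : pgraph R) n :
  pg_equiv G H -> pg_equiv (and_pow G n) (and_pow H n).
Proof.
move=> GH; elim: n => [|n IHn]; first exact: pg_equiv_refl.
apply: pg_equiv_trans (and_powS _ _) _.
exact: pg_equiv_trans (pg_equiv_and GH IHn) (pg_equiv_sym (and_powS _ _)).
Qed.

End DisjointUnionProduct.

Section Words.
Variables (R : realType) (A : finType).

(* Nested pairs rather than n.-tuple A, so that word_graph (word_seq t) and
   word_dist unfold along the recursion of and_pow. *)
Fixpoint words n : finType := if n is m.+1 then (A * words m)%type else unit.

Fixpoint word_seq n : words n -> seq A :=
  if n is m.+1 then fun t => t.1 :: word_seq t.2 else fun=> [::].

Lemma size_word_seq n (t : words n) : size (word_seq t) = n.
Proof. by elim: n t => [|n IHn] //= t; rewrite IHn. Qed.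

Fixpoint word_dist (P : fdist R A) n : fdist R (words n) :=
  if n is m.+1 then fdist_pair P (word_dist P m) else vdist one_graph.

(** A canonical representative of the words with letter counts [c]. *)
Definition type_word (c : A -> nat) : seq A :=
  flatten [seq nseq (c a) a | a <- index_enum A].

Lemma count_type_word c a : count_mem a (type_word c) = c a.
Proof.
rewrite count_flatten -map_comp sumnE big_map (bigD1_seq a) ?mem_index_enum //=.
  by rewrite count_nseq /= eqxx mul1n big1 ?addn0 // => b /negbTE ba;
     rewrite count_nseq /= ba.
exact: index_enum_uniq.
Qed.

Lemma size_type_word c : size (type_word c) = (\sum_a c a)%N.
Proof.
rewrite size_flatten /shape -map_comp sumnE big_map.
by apply: eq_bigr => a _; rewrite /= size_nseq.
Qed.

Variable G : A -> pgraph R.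

Fixpoint word_graph (s : seq A) : pgraph R :=
  if s is a :: s' then and_graph (G a) (word_graph s') else one_graph.

Lemma word_graph_cat s t :
  pg_equiv (word_graph (s ++ t)) (and_graph (word_graph s) (word_graph t)).
Proof.
elim: s => [|a s IHs] /=; first exact/pg_equiv_sym/and_graph1l.
exact: pg_equiv_trans (pg_equiv_and (pg_equiv_refl _) IHs) (and_graphA _ _ _).
Qed.

(** Permutations are generated by exchanges of adjacent blocks, and such an exchange is
    [and_graphCA]. *)
Lemma word_graph_perm s t : perm_eq s t -> pg_equiv (word_graph s) (word_graph t).
Proof.
move=> st; move: t st (pg_equiv_refl (word_graph s)).
apply: catCA_perm_ind => s1 s2 s3 /pg_equiv_trans; apply.
have catl t1 t2 t3 : pg_equiv (word_graph (t1 ++ t2 ++ t3))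
    (and_graph (word_graph t1) (and_graph (word_graph t2) (word_graph t3))).
  apply: pg_equiv_trans (word_graph_cat _ _) _.
  exact: pg_equiv_and (pg_equiv_refl _) (word_graph_cat _ _).
apply: pg_equiv_trans (catl _ _ _) _.
exact: pg_equiv_trans (and_graphCA _ _ _) (pg_equiv_sym (catl _ _ _)).
Qed.

Lemma word_graph_nseq n a : pg_equiv (word_graph (nseq n a)) (and_pow (G a) n).
Proof.
elim: n => [|n IHn] /=; first exact: pg_equiv_refl.
exact: pg_equiv_trans (pg_equiv_and (pg_equiv_refl _) IHn) (pg_equiv_sym (and_powS _ _)).
Qed.

Lemma and_pow_word_graph s m :
  pg_equiv (and_pow (word_graph s) m) (word_graph (flatten (nseq m s))).
Proof.
elim: m => [|m IHm] /=; first exact: pg_equiv_refl.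
apply: pg_equiv_trans (and_powS _ _) _.
exact: pg_equiv_trans (pg_equiv_and (pg_equiv_refl _) IHm) (pg_equiv_sym (word_graph_cat _ _)).
Qed.

Lemma and_prod_word_graph c :
  pg_equiv (and_prod (fun a => and_pow (G a) (c a))) (word_graph (type_word c)).
Proof.
rewrite /and_prod /type_word; elim: (index_enum A) => [|a r IHr].
  by rewrite big_nil; exact: pg_equiv_refl.
rewrite big_cons /=; apply: pg_equiv_trans (pg_equiv_sym (word_graph_cat _ _)).
exact: pg_equiv_and (pg_equiv_sym (word_graph_nseq _ _)) IHr.
Qed.

(** Distributivity is iterated; the base case is a union with the empty word as its only index. *)
Lemma union_pow_words (P : fdist R A) n :
  pg_equiv (and_pow (disjoint_union P G) n)
    (disjoint_union (word_dist P n) (fun t => word_graph (word_seq t))).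
Proof.
elim: n => [|n IHn].
  apply: (@pg_equiv_iso _ one_graph
    (disjoint_union (word_dist P 0) (fun t => word_graph (word_seq t)))
    (fun=> @Tagged unit tt (fun=> unit) tt) (fun=> tt)).
  - by case.
  - by move=> [[] []].
  - by move=> [] []; rewrite !cadj_refl.
  - by move=> u; rewrite /= /union_prob /= /one_prob mulr1.
apply: pg_equiv_trans (and_powS _ _) _.
apply: pg_equiv_trans (pg_equiv_and (pg_equiv_refl _) IHn) _.
exact: union_and_union.
Qed.

Definition word_entropy (s : seq A) : R := chromatic_entropy (word_graph s).

Lemma word_entropy_perm s t : perm_eq s t -> word_entropy s = word_entropy t.
Proof. by move/word_graph_perm/chromatic_entropy_equiv. Qed.

Lemma union_pow_ge (P : fdist R A) n :
  \sum_t word_dist P n t * word_entropy (word_seq t) <=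
  chromatic_entropy (and_pow (disjoint_union P G) n).
Proof.
by rewrite (chromatic_entropy_equiv (union_pow_words P n)) chromatic_entropy_union_ge.
Qed.

Lemma union_pow_le (P : fdist R A) n :
  chromatic_entropy (and_pow (disjoint_union P G) n) <=
  log2 (n.+1 ^ #|A|)%:R + \sum_t word_dist P n t * word_entropy (word_seq t).
Proof.
rewrite (chromatic_entropy_equiv (union_pow_words P n)).
(* [tau] records the letter counts. Each is at most [n], so [inord] never falls back on its default,
   and there are at most [n.+1 ^ #|A|] values. *)
pose tau (t : words n) := [ffun a => inord (count_mem a (word_seq t)) : 'I_n.+1].
have -> : (n.+1 ^ #|A| = #|{ffun A -> 'I_n.+1}|)%N by rewrite card_ffun card_ord.
apply: (@chromatic_entropy_union_map R _ _ tau _ _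
  (fun j => word_graph (type_word (fun a => j a)))) => t.
apply: word_graph_perm; apply/allP => a _ /=.
by rewrite count_type_word ffunE inordK // ltnS -[n in (_ <= n)%N](size_word_seq t) count_size.
Qed.

(** * Lipschitz dependence of word entropy on letter counts *)

Lemma word_entropy_cat_le s t :
  word_entropy (s ++ t) <= word_entropy s + word_entropy t.
Proof.
by rewrite /word_entropy (chromatic_entropy_equiv (word_graph_cat s t))
           chromatic_entropy_and_le.
Qed.

Lemma word_entropy_cat_ge s t : word_entropy s <= word_entropy (s ++ t).
Proof.
by rewrite /word_entropy (chromatic_entropy_equiv (word_graph_cat s t))
           chromatic_entropy_and_ge.
Qed.

Lemma chromatic_entropy_one : chromatic_entropy (@one_graph R) = 0.
Proof.
apply/eqP; rewrite eq_le chromatic_entropy_ge0 andbT.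
have idc : coloring (@id (vert (@one_graph R))) by [].
apply: le_trans (chromatic_entropy_le idc) _.
rewrite entropy_eta big1 // => u _; rewrite /color_law big_pred1_eq.
by rewrite /= /one_prob /eta /log2 ln1 mul0r mulr0 oppr0.
Qed.

(** The sum dominates each [chromatic_entropy (G a)] and serves as a uniform price per letter. *)
Definition letter_bound : R := \sum_a chromatic_entropy (G a).

Lemma letter_bound_ge0 : 0 <= letter_bound.
Proof. by rewrite sumr_ge0 // => a _; exact: chromatic_entropy_ge0. Qed.

Lemma word_entropy_le_size s : word_entropy s <= letter_bound * (size s)%:R.
Proof.
elim: s => [|a s IHs].
  by rewrite mulr0 /word_entropy /= chromatic_entropy_one.
rewrite [size _]/= -natr1 mulrDr mulr1 addrC.
apply: le_trans (chromatic_entropy_and_le _ _) _.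
apply: lerD IHs; rewrite /letter_bound (bigD1 a) //= lerDl sumr_ge0 // => b _.
exact: chromatic_entropy_ge0.
Qed.

(** Appending to [t] the letters [d] that it lacks makes [s] part of a rearrangement of [t ++ d].
    Monotonicity compares the two, and subadditivity charges for [d]. Truncated subtraction counts
    only missing letters. *)
Lemma word_entropy_lipschitz s t :
  word_entropy s <= word_entropy t +
    letter_bound * (\sum_a (count_mem a s - count_mem a t))%N%:R.
Proof.
pose d := type_word (fun a => (count_mem a s - count_mem a t)%N).
have /count_subseqP[u ud su] a : (count_mem a s <= count_mem a (t ++ d))%N.
  by rewrite count_cat count_type_word -leq_subLR.
have [r tdr] := perm_to_subseq ud.
have {ud su tdr} /word_entropy_perm E : perm_eq (t ++ d) (s ++ r).
  by rewrite (permPl tdr) perm_cat2r perm_sym.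
apply: le_trans (word_entropy_cat_ge s r) _; rewrite -E.
apply: le_trans (word_entropy_cat_le t d) _.
by rewrite lerD2l -size_type_word word_entropy_le_size.
Qed.

Lemma word_entropy_dist s t :
  `|word_entropy s - word_entropy t| <=
    letter_bound * \sum_a `|(count_mem a s)%:R - (count_mem a t)%:R|.
Proof.
have half u v : word_entropy u - word_entropy v <=
    letter_bound * \sum_a `|(count_mem a u)%:R - (count_mem a v)%:R|.
  rewrite lerBlDl; apply: le_trans (word_entropy_lipschitz u v) _.
  rewrite lerD2l ler_wpM2l ?letter_bound_ge0 // natr_sum ler_sum // => a _.
  have [h|h] := leqP (count_mem a v) (count_mem a u).
    by rewrite natrB // ler_norm.
  by move: (ltnW h); rewrite -subn_eq0 => /eqP ->; rewrite normr_ge0.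
rewrite ler_norml half andbT lerNl opprB.
apply: le_trans (half t s) _; rewrite le_eqVlt; apply/orP; left; apply/eqP.
by congr (_ * _); apply: eq_bigr => a _; rewrite distrC.
Qed.

End Words.

(** * Fekete's lemma and concentration of letter counts *)

Section Limits.
Variable R : realType.
Local Open Scope classical_set_scope.

Lemma cvgn_distP (u : nat -> R) (l : R) :
  u @ \oo --> l <->
  forall e, 0 < e -> exists N, forall n, (N <= n)%N -> `|l - u n| < e.
Proof.
split=> [/cvgrPdist_lt ul e e0|ul].
  by have [N _ NP] := ul e e0; exists N => n /NP.
apply/cvgrPdist_lt => e e0; have [N NP] := ul e e0.
by exists N => // n /= /NP.
Qed.

Lemma natr_eventually_gt (x : R) : exists N, forall n, (N <= n)%N -> x < n%:R.
Proof.
exists (Num.bound `|x|) => n Nn; apply: le_lt_trans (ler_norm x) _.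
by apply: lt_le_trans (archi_boundP (normr_ge0 x)) _; rewrite ?ler_nat //.
Qed.

(** The limit is the infimum of [a n / n]: a nearly optimal [N] controls all large [n] through
    division of [n] by [N]. *)
Lemma fekete (a : nat -> R) : (forall n, 0 <= a n) ->
  (forall m n, a (m + n)%N <= a m + a n) ->
  cvgn (fun n => n%:R^-1 * a n).
Proof.
(* Index 0 is excluded, since [0^-1 = 0] would pull the infimum down to 0. *)
move=> a0 aD; pose E := [set x : R | exists n, (0 < n)%N /\ x = n%:R^-1 * a n].
have lE : lbound E 0.
  by move=> _ [n [_ ->]]; rewrite mulr_ge0 ?invr_ge0.
have infE : has_inf E.
  by split; [exists (1%:R^-1 * a 1%N); exists 1%N|exists 0].
apply/cvg_ex; exists (inf E); apply/cvgn_distP => e e0.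
have e20 : 0 < e / 2 by rewrite divr_gt0.
have [_ [N [N0 ->]] hN] := inf_adherent e20 infE.
have NR0 : 0 < N%:R :> R by rewrite ltr0n.
(* [B] bounds [a r] for every remainder [r < N] at once. *)
pose B := \sum_(r < N) a r.
have aq q r : a (q * N + r)%N <= q%:R * a N + a r.
  elim: q => [|q IHq]; first by rewrite mul0n add0n mul0r add0r.
  rewrite mulSn -addnA; apply: le_trans (aD _ _) _.
  by rewrite -natr1 mulrDl mul1r addrAC [leRHS]addrC lerD2l.
have aB n : a n <= n%:R * (N%:R^-1 * a N) + B.
  rewrite {1}(divn_eq n N); apply: le_trans (aq _ _) _; apply: lerD.
    rewrite mulrA ler_wpM2r // ler_pdivlMr // -natrM ler_nat.
    exact: leq_divM.
  rewrite /B (bigD1 (Ordinal (ltn_pmod n N0))) //= lerDl.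
  by apply: sumr_ge0.
have [M MP] := natr_eventually_gt (B / (e / 2)).
exists (maxn 1 M) => n; rewrite geq_max => /andP[n0 /MP Mn].
have nR0 : 0 < n%:R :> R by rewrite ltr0n.
have hinf : inf E <= n%:R^-1 * a n by apply: ge_inf; [exists 0|exists n].
rewrite distrC ger0_norm ?subr_ge0 // ltrBlDl.
rewrite mulrC ltr_pdivrMr //.
apply: le_lt_trans (aB n) _.
have : B < e / 2 * n%:R by rewrite -ltr_pdivrMl // mulrC.
have : n%:R * (N%:R^-1 * a N) < n%:R * (inf E + e / 2) by rewrite ltr_pM2l.
by lra.
Qed.

End Limits.

Section TypeConcentration.
Variables (R : realType) (A : finType) (P : fdist R A).

Lemma count_mean n b :
  \sum_t word_dist P n t * ((count_mem b (word_seq t))%:R - n%:R * P b) = 0.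
Proof.
elim: n => [|n IHn].
  by rewrite big1 // => t _; rewrite mul0r subr0 mulr0.
rewrite -(pair_bigA _ (fun a t => P a * word_dist P n t *
   ((count_mem b (a :: word_seq t))%:R - n.+1%:R * P b))) /=.
under eq_bigr => a _.
  rewrite (eq_bigr (fun t => P a * ((a == b)%:R - P b) * word_dist P n t +
    P a * (word_dist P n t * ((count_mem b (word_seq t))%:R - n%:R * P b)))).
    rewrite big_split /= -!mulr_sumr IHn mulr0 addr0 prob_sum1 mulr1; over.
  by move=> t _; rewrite natrD -natr1; ring.
rewrite (eq_bigr (fun a => P a * (a == b)%:R - P a * P b)); last by move=> a _; ring.
rewrite sumrB -mulr_suml prob_sum1 mul1r (bigD1 b) //= eqxx mulr1 big1 ?addr0 ?subrr //.
by move=> a /negbTE ->; rewrite mulr0.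
Qed.

(** Variance of a sum of independent letters: when the first letter is split off, the cross term
    vanishes by [count_mean], and that letter contributes at most 1. *)
Lemma count_second_moment n b :
  \sum_t word_dist P n t * ((count_mem b (word_seq t))%:R - n%:R * P b) ^+ 2
    <= n%:R.
Proof.
have P1 : P b <= 1.
  by rewrite -(prob_sum1 P) (bigD1 b) //= lerDl sumr_ge0 // => *; apply: prob_ge0.
elim: n => [|n IHn].
  by rewrite big1 // => t _; rewrite mul0r subr0 expr0n mulr0.
rewrite -(pair_bigA _ (fun a t => P a * word_dist P n t *
   ((count_mem b (a :: word_seq t))%:R - n.+1%:R * P b) ^+ 2)) /=.
under eq_bigr => a _.
  rewrite (eq_bigr (fun t => P a * ((a == b)%:R - P b) ^+ 2 * word_dist P n t +
    (P a * ((a == b)%:R - P b) * 2 *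
      (word_dist P n t * ((count_mem b (word_seq t))%:R - n%:R * P b)) +
    P a * (word_dist P n t *
      ((count_mem b (word_seq t))%:R - n%:R * P b) ^+ 2)))).
    rewrite !big_split /= -!mulr_sumr count_mean mulr0 add0r prob_sum1 mulr1; over.
  by move=> t _; rewrite natrD -natr1; ring.
rewrite big_split /= -mulr_suml prob_sum1 mul1r -natr1 addrC lerD //.
rewrite -[leRHS](prob_sum1 P) ler_sum // => a _; rewrite ler_piMr ?prob_ge0 //.
rewrite -[leRHS](expr1n _ 2) -[leLHS]real_normK ?num_real // ler_pXn2r ?nnegrE // ler_norml.
by have := prob_ge0 P b; case: (a == b) => /= Pb0; apply/andP; split; lra.
Qed.

Lemma count_mean_deviation n b : (0 < n)%N ->
  \sum_t word_dist P n t * `|(count_mem b (word_seq t))%:R - n%:R * P b|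
    <= Num.sqrt n%:R.
Proof.
move=> n0; set s := Num.sqrt _.
have s0 : 0 < s by rewrite sqrtr_gt0 ltr0n.
have s2 : s ^+ 2 = n%:R by rewrite sqr_sqrtr.
pose X (t : words A n) := (count_mem b (word_seq t))%:R - n%:R * P b : R.
(* The arithmetic-geometric inequality replaces Cauchy-Schwarz; with [s] the root of [n], both terms
   have mean at most [s / 2]. *)
have step (x : R) : `|x| <= x ^+ 2 / (2 * s) + s / 2.
  rewrite -subr_ge0 -[x ^+ 2]real_normK ?num_real //.
  have -> : `|x| ^+ 2 / (2 * s) + s / 2 - `|x| = (`|x| - s) ^+ 2 / (2 * s).
    by field; rewrite gt_eqF.
  by rewrite divr_ge0 ?sqr_ge0 // mulr_ge0 // ltW.
apply: (@le_trans _ _ (\sum_t (word_dist P n t * X t ^+ 2 / (2 * s) +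
    word_dist P n t * (s / 2)))).
  apply: ler_sum => t _; rewrite -mulrA -mulrDr ler_wpM2l ?prob_ge0 //.
rewrite big_split /= -!mulr_suml prob_sum1 mul1r.
have h : (\sum_t word_dist P n t * X t ^+ 2) / (2 * s) <= n%:R / (2 * s).
  by rewrite ler_wpM2r ?invr_ge0 ?mulr_ge0 ?(ltW s0) ?count_second_moment.
have E : n%:R / (2 * s) = s / 2 by rewrite -s2; field; rewrite gt_eqF.
by move: h; rewrite E; lra.
Qed.

(** * Comparison of a power of the union with a word of exact type *)

Variable G : A -> pgraph R.

(** The term [4 / ln 2] pays for the number of types, [letter_bound G] for the deviation of the
    letter counts. *)
Definition rate_const : R := #|A|%:R * (4 / ln 2 + letter_bound G).

Lemma rate_const_ge0 : 0 <= rate_const.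
Proof.
by rewrite mulr_ge0 // addr_ge0 ?letter_bound_ge0 // divr_ge0 // ltW ?ln2_gt0.
Qed.

(** The 4 arises from [ln n.+1%:R = 2 * ln (Num.sqrt n.+1%:R)], from [ln x < x], and from
    [n.+1 <= 4 * n]. *)
Lemma log2_exp_le n d : (0 < n)%N ->
  log2 (n.+1 ^ d)%:R <= d%:R * (4 / ln 2) * Num.sqrt n%:R :> R.
Proof.
move=> n0; have n10 : 0 < n.+1%:R :> R by rewrite ltr0n.
have h : ln n.+1%:R <= 4 * Num.sqrt n%:R :> R.
  have s10 : 0 < Num.sqrt n.+1%:R :> R by rewrite sqrtr_gt0.
  have -> : ln n.+1%:R = ln (Num.sqrt n.+1%:R) * 2 :> R.
    by rewrite -[in LHS](sqr_sqrtr (ltW n10)) lnXn // mulr_natr.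
  have /ltW h1 := ln_sublinear s10.
  have h2 : Num.sqrt n.+1%:R <= 2 * Num.sqrt n%:R :> R.
    rewrite -(@ler_pXn2r _ 2) ?nnegrE ?mulr_ge0 ?sqrtr_ge0 // exprMn !sqr_sqrtr //.
    by rewrite -natrX -natrM ler_nat; lia.
  by lra.
rewrite /log2 natrX lnXn // -[X in X / _ <= _]mulr_natl.
have -> : d%:R * (4 / ln 2) * Num.sqrt n%:R = d%:R * (4 * Num.sqrt n%:R) / ln 2 :> R.
  by ring.
by rewrite ler_pM2r ?invr_gt0 ?ln2_gt0 // ler_wpM2l.
Qed.

(** The mean [M] over random words is close to the value at [s] by the Lipschitz bound, and the
    power exceeds [M] by at most the logarithm of the number of types. *)
Lemma union_pow_word_entropy n (s : seq A) : (0 < n)%N ->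
  (forall a, (count_mem a s)%:R = n%:R * P a) ->
  `|chromatic_entropy (and_pow (disjoint_union P G) n) - word_entropy G s|
    <= rate_const * Num.sqrt n%:R.
Proof.
move=> n0 sP.
set h := word_entropy G s; set H := chromatic_entropy _.
pose M := \sum_t word_dist P n t * word_entropy G (word_seq t).
have Mh : `|M - h| <= letter_bound G * (#|A|%:R * Num.sqrt n%:R).
  have -> : M - h = \sum_t word_dist P n t * (word_entropy G (word_seq t) - h).
    under [RHS]eq_bigr do rewrite mulrBr.
    by rewrite sumrB -mulr_suml prob_sum1 mul1r.
  apply: le_trans (ler_norm_sum _ _ _) _.
  apply: (@le_trans _ _ (\sum_t letter_bound G * \sum_a word_dist P n t *
      `|(count_mem a (word_seq t))%:R - n%:R * P a|)).
    apply: ler_sum => t _; rewrite normrM ger0_norm ?prob_ge0 // -mulr_sumr mulrCA.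
    rewrite ler_wpM2l ?prob_ge0 //.
    under eq_bigr do rewrite -sP.
    exact: word_entropy_dist.
  rewrite -mulr_sumr ler_wpM2l ?letter_bound_ge0 // exchange_big /=.
  apply: le_trans (ler_sum _ (fun a _ => count_mean_deviation a n0)) _.
  by rewrite sumr_const mulr_natl.
have MH : M <= H := union_pow_ge G P n.
have HM : H <= log2 (n.+1 ^ #|A|)%:R + M := union_pow_le G P n.
have L := log2_exp_le #|A| n0.
have -> : rate_const * Num.sqrt n%:R = #|A|%:R * (4 / ln 2) * Num.sqrt n%:R +
    letter_bound G * (#|A|%:R * Num.sqrt n%:R) by rewrite /rate_const; ring.
move: Mh; rewrite !ler_norml; set x := letter_bound G * _ => /andP[M1 M2].
have : 0 <= #|A|%:R * (4 / ln 2) * Num.sqrt n%:R :> R.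
  by rewrite !mulr_ge0 ?invr_ge0 ?sqrtr_ge0 // ltW ?ln2_gt0.
by move=> ?; apply/andP; split; lra.
Qed.

End TypeConcentration.

(** * Passage to the limit along multiples of k *)

Lemma count_tnth (A : eqType) k (s : k.-tuple A) a :
  count_mem a s = #|[pred t : 'I_k | tnth s t == a]|.
Proof.
rewrite -[in LHS](map_tnth_enum s) -sum1_count big_map big_enum_cond /= sum1_card.
by apply: eq_card => t; rewrite !inE.
Qed.

(* When P is a type of sequences of length k, k%:R * P a is a natural number,
   so [Num.truncn] only reads it back as an element of nat. *)
Theorem mainTheorem1 (R : realType) (A : finType) (P : fdist R A)
    (G : A -> pgraph R) (k : nat) :
  (0 < k)%N -> is_type k P ->
  complementary_entropy (disjoint_union P G) =
  k%:R^-1 * complementary_entropy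
              (and_prod (fun a => and_pow (G a) (Num.truncn (k%:R * P a)))).
Proof.
move=> k0 [s sP]; set Q := and_prod _; set U := disjoint_union P G.
have kR0 : 0 < k%:R :> R by rewrite ltr0n.
have count_s a : (count_mem a s)%:R = k%:R * P a.
  by rewrite sP /emp_type mulrA mulfV ?mul1r ?gt_eqF // count_tnth.
(* Up to equivalence, [Q] is the graph of the word [s], so its powers are graphs of repetitions of
   [s]. *)
have QE m : chromatic_entropy (and_pow Q m) = word_entropy G (flatten (nseq m (tval s))).
  apply: chromatic_entropy_equiv.
  apply: pg_equiv_trans (and_pow_word_graph _ _ _); apply: pg_equiv_and_pow.
  apply: pg_equiv_trans (and_prod_word_graph _ _) _; apply: word_graph_perm.
  by apply/allP => a _ /=; rewrite count_type_word -count_s natrK.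
pose u n : R := n%:R^-1 * chromatic_entropy (and_pow U n).
have cu : cvgn u.
  apply: fekete => [n|m n]; first exact: chromatic_entropy_ge0.
  by rewrite (chromatic_entropy_equiv (and_powD U m n)) chromatic_entropy_and_le.
pose C := rate_const G.
have C0 : 0 <= C := rate_const_ge0 G.
(* The repeated word has exact type at length [m * k]; dividing the error [C * Num.sqrt (m * k)%:R]
   by that length leaves at most [C / Num.sqrt m%:R], as [1 <= k]. *)
have dist m : (0 < m)%N ->
    `|u (m * k)%N - k%:R^-1 * (m%:R^-1 * chromatic_entropy (and_pow Q m))|
      <= C / Num.sqrt m%:R.
  move=> m0; have n0 : (0 < m * k)%N by rewrite muln_gt0 m0.
  have mR0 : 0 < m%:R :> R by rewrite ltr0n.
  have nR0 : 0 < (m * k)%:R :> R by rewrite ltr0n.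
  rewrite /u mulrA -invfM -[k%:R * _]natrM [(k * m)%N]mulnC -mulrBr QE.
  rewrite normrM gtr0_norm ?invr_gt0 // mulrC ler_pdivrMr //.
  have count_n a : (count_mem a (flatten (nseq m (tval s))))%:R = (m * k)%:R * P a.
    by rewrite count_flatten map_nseq sumn_nseq mulnC !natrM count_s mulrA.
  apply: le_trans (union_pow_word_entropy G n0 count_n) _.
  rewrite -[rate_const G]/C -[leRHS]mulrA ler_wpM2l //.
  have sm0 : 0 < Num.sqrt m%:R :> R by rewrite sqrtr_gt0.
  have k1 : 1 <= k%:R :> R by rewrite ler1n.
  rewrite mulrC ler_pdivlMr // natrM sqrtrM // mulrAC -expr2 sqr_sqrtr //.
  rewrite ler_wpM2l // -[leRHS]sqr_sqrtr // expr2 ler_peMr ?sqrtr_ge0 //.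
  by rewrite -[X in X <= _]sqrtr1 ler_wsqrtr.
have cv : ((fun m => m%:R^-1 * chromatic_entropy (and_pow Q m) : R) @ \oo
    --> k%:R * limn u)%classic.
  apply/cvgn_distP => e e0.
  (* Two errors are added and then scaled by [k], hence the tolerance [e / (2 * k%:R)] for each. *)
  have e20 : 0 < e / (2 * k%:R) by rewrite divr_gt0 ?mulr_gt0.
  have [N1 hN1] := (cvgn_distP u (limn u)).1 cu _ e20.
  have [N2 hN2] := natr_eventually_gt ((C / (e / (2 * k%:R))) ^+ 2).
  exists (maxn 1 (maxn N1 N2)) => m; rewrite !geq_max => /and3P[m0 m1 m2].
  set v := _ * chromatic_entropy _.
  have h1 : `|limn u - u (m * k)%N| < e / (2 * k%:R).
    by apply: hN1; apply: leq_trans m1 _; rewrite leq_pmulr.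
  have h2 : C / Num.sqrt m%:R < e / (2 * k%:R).
    have sm0 : 0 < Num.sqrt m%:R :> R by rewrite sqrtr_gt0 ltr0n.
    rewrite ltr_pdivrMr // mulrC -ltr_pdivrMr //.
    have x0 : 0 <= C / (e / (2 * k%:R)) by rewrite divr_ge0 // ltW.
    rewrite -(ger0_norm x0) -sqrtr_sqr.
    by rewrite ltr_sqrt ?ltr0n // hN2.
  have -> : k%:R * limn u - v = k%:R * ((limn u - u (m * k)%N) +
      (u (m * k)%N - k%:R^-1 * v)) by field; rewrite gt_eqF.
  rewrite normrM gtr0_norm // mulrC -ltr_pdivlMr //.
  apply: le_lt_trans (ler_normD _ _) _.
  have -> : e / k%:R = e / (2 * k%:R) + e / (2 * k%:R).
    by field; rewrite gt_eqF.
  exact: ltrD h1 (le_lt_trans (dist _ m0) h2).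
rewrite /complementary_entropy (cvg_lim _ cv) //.
by rewrite mulrA mulVf ?mul1r // gt_eqF.
Qed.
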